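(* Let $k \geq 3$ and let $P \in \mathrm{PLS}(2,3;n)$. Let $\sigma$ be the $(1,2)$-row-permutation of $P$ and let $T=\{P(1,1),P(1,2),P(1,3)\}$. Suppose that the disjoint cycle representation of $\sigma$ consists of exactly one cycle of length $3$, whose three elements are exactly the elements of $T$, together with exactly $k+2$ cycles of length $2$, none of whose elements lies in $T$ (so that $n = 3 + 2(k+2)$). Then $P$ is completable.
   Context: $\mathrm{PLS}(2,3;n)$ denotes the set of $n\times n$ partial Latin squares on the symbols $\{1,\dots,n\}$ (each cell empty or containing one symbol, no symbol repeated in any row or column) in which rows $1$ and $2$ and columns $1,2,3$ are completely filled and all other cells are empty. The $(1,2)$-row-permutation of such $P$ is the permutation $\sigma$ of $\{1,\dots,n\}$ defined by $\sigma(P(1,i)) = P(2,i)$ for all $i \in \{1,\dots,n\}$. $P$ is completable if there is an $n\times n$ Latin square agreeing with $P$ on all nonempty cells of $P$. *)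

(* Defs.v *)
From mathcomp Require Import all_boot all_order all_fingroup.
Set Implicit Arguments. Unset Strict Implicit. Unset Printing Implicit Defensive.

(* An n x n partial array: rows, columns and symbols are indexed by 'I_n
   (row/column/symbol i+1 of the paper is index i here). None = empty cell. *)
Definition parray (n : nat) := 'I_n -> 'I_n -> option 'I_n.

Definition is_PLS n (P : parray n) : Prop :=
  (forall i j1 j2 s, P i j1 = Some s -> P i j2 = Some s -> j1 = j2) /\
  (forall j i1 i2 s, P i1 j = Some s -> P i2 j = Some s -> i1 = i2).

Definition in_PLS23 n (P : parray n) : Prop :=
  is_PLS P /\
  forall i j : 'I_n, (P i j != None) = ((val i < 2) || (val j < 3)).

Definition row12_perm n (P : parray n) (sigma : {perm 'I_n}) : Prop :=
  forall i1 i2 j : 'I_n, val i1 = 0 -> val i2 = 1 ->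
    P i2 j = omap sigma (P i1 j).

Definition first3 n (P : parray n) : {set 'I_n} :=
  [set s | [exists i : 'I_n, [exists j : 'I_n,
     [&& val i == 0, val j < 3 & P i j == Some s]]]].

Definition completable n (P : parray n) : Prop :=
  exists L : 'I_n -> 'I_n -> 'I_n,
    (forall i, injective (L i)) /\ (forall j, injective (fun i => L i j)) /\
    (forall i j s, P i j = Some s -> L i j = s).

(* Main.v *)
Require Import Defs.
From mathcomp Require Import all_boot all_order all_fingroup.
From mathcomp Require Import zify.

(** Galvin's theorem does all the work: a bipartite multigraph of maximum degree [d] can be
    properly edge-coloured from arbitrary lists of size [d].

    Let [T] be the set of the first three symbols of row 1.  As [T] is an orbit of [sigma],
    the top left 2 x 3 block of [P] contains exactly the symbols of [T].  Join a symbol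
    [s] outside [T] to a column [c] beyond the third when [s] is absent from the two filled
    cells of [c]; this graph is [(n-5)]-regular.  Give the edge [(s, c)] the list of rows
    below the second in which [s] is still missing: there are [n-5] of them.  A colouring
    from these lists places every symbol outside [T] in every row and column.

    What remains is to place [T].  Each row and column has three cells not occupied by
    symbols outside [T].  Below the second row, and with the first three columns merged into
    one vertex, these cells form a bipartite multigraph of maximum degree 3, which is
    3-edge-coloured by [T].  The merged vertex has exactly three edges, carrying the three
    symbols of [T], so a renaming of the colours makes the colouring agree with [P]. *)

Set Implicit Arguments. Unset Strict Implicit. Unset Printing Implicit Defensive.

(** * Edge colourings of bipartite multigraphs: Kempe chains and Koenig's theorem *)

Section EdgeColouring.

Variables (E X Y : finType) (x : E -> X) (y : E -> Y).
Implicit Types (A K : {set E}) (c : E -> nat).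

(** Edges are points of [E] with endpoint maps [x] and [y], so parallel edges are allowed. The
    relation is reflexive, which is why properness takes the form of injectivity on adjacent
    pairs. *)
Definition adj (e e' : E) := (x e == x e') || (y e == y e').

Lemma adj_sym e e' : adj e e' = adj e' e.
Proof. by rewrite /adj eq_sym [y e == _]eq_sym. Qed.

Definition proper_colouring (C : Type) A (f : E -> C) :=
  {in A &, forall e e', adj e e' -> f e = f e' -> e = e'}.

Definition xstar A e := [set e' in A | x e' == x e].
Definition ystar A e := [set e' in A | y e' == y e].

Lemma exists_unused_colour A c d :
  #|A| < d -> exists2 a, a < d & {in A, forall e, c e != a}.
Proof.
move=> ltAd; have [|nsub] := boolP (all (mem (map c (enum A))) (iota 0 d)).
  move/allP=> sub; have := uniq_leq_size (iota_uniq 0 d) sub.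
  by rewrite size_iota size_map -cardE leqNgt ltAd.
have /allPn[a] := nsub; rewrite mem_iota /= add0n => lt_ad /= /mapP notin.
exists a => // e eA; apply/eqP => ca; apply: notin.
by exists e; rewrite ?mem_enum.
Qed.

Lemma connect_last (V : finType) (r : rel V) u v :
  connect r u v -> v = u \/ exists2 w, connect r u w & r w v.
Proof.
case/connectP=> p; case/lastP: p => [_ ->|p w]; first by left.
rewrite rcons_path last_rcons => /andP[pth rw] ->; right.
by exists (last u p) => //; apply/connectP; exists p.
Qed.

Section KempeChain.

Variables (A : {set E}) (c : E -> nat) (a b : nat) (u : X).
Hypotheses (proper_c : proper_colouring A c) (missing_a : {in A, forall e, x e = u -> c e != a}).

(** Arcs leave the [X] side along colour [b] and the [Y] side along colour [a]. As [a] is missing at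
    [u], directed walks from [u] trace its whole alternating component. *)
Definition kempe_step : rel (X + Y) := fun v w =>
  match v, w with
  | inl v, inr w => [exists e in A, [&& c e == b, x e == v & y e == w]]
  | inr v, inl w => [exists e in A, [&& c e == a, x e == w & y e == v]]
  | _, _ => false
  end.

Definition kempe_chain := connect kempe_step (inl u).

(** One direction follows an arc. In the other, the last arc of the walk has the colour of [e] and
    shares an end with it, hence comes from [e] by properness; the empty walk is excluded because
    [a] is missing at [u]. *)
Lemma kempe_chain_edge e : e \in A -> (c e == a) || (c e == b) ->
  kempe_chain (inl (x e)) = kempe_chain (inr (y e)).
Proof.
move=> eA cab; apply/idP/idP => reach.
- have [cb|ncb] := eqVneq (c e) b.
    apply: connect_trans reach (connect1 _) => /=.
    by apply/exists_inP; exists e; rewrite // cb !eqxx.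
  rewrite (negPf ncb) orbF in cab.
  case: (connect_last reach) => [[xu]|[[v|v] rv //=]].
    by rewrite (negPf (missing_a eA xu)) in cab.
  case/exists_inP=> e' e'A /and3P[/eqP ca' /eqP xe' /eqP ye'].
  have <- : e' = e by apply: proper_c; rewrite // /adj ?xe' ?eqxx // ca' (eqP cab).
  by rewrite ye'.
- have [ca|nca] := eqVneq (c e) a.
    apply: connect_trans reach (connect1 _) => /=.
    by apply/exists_inP; exists e; rewrite // ca !eqxx.
  rewrite (negPf nca) /= in cab.
  case: (connect_last reach) => [//|[[v|v] rv //=]].
  case/exists_inP=> e' e'A /and3P[/eqP cb' /eqP xe' /eqP ye'].
  have <- : e' = e.
    by apply: proper_c; rewrite // /adj ?ye' ?eqxx ?orbT // cb' (eqP cab).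
  by rewrite xe'.
Qed.

Lemma kempe_chain_missing w :
  {in A, forall e, y e = w -> c e != b} -> ~~ kempe_chain (inr w).
Proof.
move=> miss; apply/negP => /connect_last[//|[[v|v] _ //=]].
case/exists_inP=> e eA /and3P[/eqP cb _ /eqP yw].
by have := miss e eA yw; rewrite cb eqxx.
Qed.

(** Testing the [X] end suffices: by [kempe_chain_edge], an edge coloured [a] or [b] has both ends
    in the chain or neither. *)
Definition kempe_swap e :=
  if ~~ kempe_chain (inl (x e)) then c e
  else if c e == a then b else if c e == b then a else c e.

Lemma kempe_swap_proper : proper_colouring A kempe_swap.
Proof.
suff half e e' : e \in A -> e' \in A -> adj e e' -> kempe_swap e = kempe_swap e' ->
    kempe_chain (inl (x e')) -> e = e'.
  move=> e e' eA e'A ad eq_c.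
  have [r'|nr'] := boolP (kempe_chain (inl (x e'))); first exact: half.
  have [r|nr] := boolP (kempe_chain (inl (x e))).
    by apply/esym; apply: half; rewrite // adj_sym.
  by apply: proper_c => //; move: eq_c; rewrite /kempe_swap nr nr'.
move=> eA e'A ad; rewrite /kempe_swap => + r'; rewrite r' /=.
have [r|nr] := boolP (kempe_chain (inl (x e))) => /=.
  move=> eq_c; apply: proper_c => //; move: eq_c.
  by do 4?case: eqP; congruence.
(* Here [e] is off the chain and [e'] on it, so they cannot share an end while both using [a] or
   [b]. *)
have sep : (c e == a) || (c e == b) -> ~~ ((c e' == a) || (c e' == b)).
  move=> cab; apply/negP => cab'.
  case/orP: ad => /eqP eq_end; first by rewrite eq_end r' in nr.
  by rewrite (kempe_chain_edge eA cab) eq_end -(kempe_chain_edge e'A cab') r' in nr.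
have [ca'|nca'] := eqVneq (c e') a.
  by move=> cb; move: sep; rewrite cb eqxx orbT ca' eqxx => /(_ isT).
have [cb'|ncb'] := eqVneq (c e') b.
  by move=> ca; move: sep; rewrite ca eqxx cb' eqxx orbT => /(_ isT).
exact: proper_c.
Qed.

End KempeChain.

(** Remove [e0], colour the rest, and choose [a] free at its [X] end and [b] free at its [Y] end.
    Swapping along the chain from the [X] end frees [b] there too; the chain never reaches the [Y]
    end, since the [Y] side is entered only along colour [b]. *)
Lemma koenig A d :
    {in A, forall e, #|xstar A e| <= d} -> {in A, forall e, #|ystar A e| <= d} ->
  exists c, {in A, forall e, c e < d} /\ proper_colouring A c.
Proof.
move: {2}#|A| (leqnn #|A|) => m; elim: m A => [|m IH] A leAm dx dy.
  move: leAm; rewrite leqn0 cards_eq0 => /eqP ->.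
  by exists (fun=> 0); split=> e; rewrite inE.
have [->|[e0 e0A]] := set_0Vmem A.
  by exists (fun=> 0); split=> e; rewrite inE.
pose B := A :\ e0.
have subBA : {subset B <= A} by move=> e; rewrite !inE => /andP[].
have [| | | c [c_lt c_proper]] := IH B.
- by move: leAm; rewrite (cardsD1 e0) e0A.
- move=> e /subBA eA; apply: leq_trans (dx e eA); apply: subset_leq_card.
  by apply/subsetP => e'; rewrite !inE => /andP[/andP[_ ->]].
- move=> e /subBA eA; apply: leq_trans (dy e eA); apply: subset_leq_card.
  by apply/subsetP => e'; rewrite !inE => /andP[/andP[_ ->]].
have [a a_lt missa] : exists2 a, a < d & {in xstar B e0, forall e, c e != a}.
  apply: exists_unused_colour; apply: leq_trans (dx e0 e0A).
  rewrite [X in _ < X](cardsD1 e0) inE e0A eqxx add1n ltnS subset_leq_card //.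
  by apply/subsetP => e; rewrite !inE -!andbA.
have [b b_lt missb] : exists2 b, b < d & {in ystar B e0, forall e, c e != b}.
  apply: exists_unused_colour; apply: leq_trans (dy e0 e0A).
  rewrite [X in _ < X](cardsD1 e0) inE e0A eqxx add1n ltnS subset_leq_card //.
  by apply/subsetP => e; rewrite !inE -!andbA.
have {}missa : {in B, forall e, x e = x e0 -> c e != a}.
  by move=> e eB xe; apply: missa; rewrite inE eB xe /=.
have {}missb : {in B, forall e, y e = y e0 -> c e != b}.
  by move=> e eB ye; apply: missb; rewrite inE eB ye /=.
pose c' := kempe_swap B c a b (x e0).
have inB e : e \in A -> e != e0 -> e \in B by rewrite !inE => -> ->.
have c'b e : e \in B -> adj e e0 -> c' e != b.
  move=> eB; rewrite /c' /kempe_swap => /orP[] /eqP eq_end.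
    have -> /= : kempe_chain B c a b (x e0) (inl (x e)).
      by rewrite eq_end /kempe_chain connect0.
    rewrite (negPf (missa e eB eq_end)).
    have [cb|//] := eqVneq (c e) b.
    by rewrite -cb eq_sym missa.
  case: ifPn => [_|]; first exact: missb.
  rewrite negbK => chain; rewrite (negPf (missb e eB eq_end)).
  have [ca|_] := eqVneq (c e) a; last exact: missb.
  move: chain; rewrite (kempe_chain_edge c_proper missa eB) ?ca ?eqxx // eq_end.
  by rewrite (negPf (kempe_chain_missing _ _ missb)).
exists (fun e => if e == e0 then b else c' e); split.
  move=> e eA; case: eqVneq => [//|ne]; rewrite /c' /kempe_swap.
  by do 3?[case: ifP => // _]; apply: c_lt; apply: inB.
move=> e e' eA e'A.
have [->|ne] := eqVneq e e0; have [->|ne'] := eqVneq e' e0 => // ad eq_c.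
- by have := c'b e' (inB _ e'A ne'); rewrite adj_sym -eq_c eqxx => /(_ ad).
- by have := c'b e (inB _ eA ne); rewrite eq_c eqxx => /(_ ad).
- exact: (kempe_swap_proper c_proper missa) (inB _ eA ne) (inB _ e'A ne') ad eq_c.
Qed.

(** * Kernels and Galvin's list colouring theorem *)

Section Kernels.

Variable c : E -> nat.

(* Galvin's orientation of the line graph: [dominates e e'] is an arc from [e] to [e']. *)
Definition dominates e e' :=
  (x e' == x e) && (c e < c e') || (y e' == y e) && (c e' < c e).

(** This is stable matching: an [X] end prefers large colours, a [Y] end small ones. [M] holds the
    favourite edge of each [X] end; if two of them meet in [Y], the one of larger colour is rejected
    and induction applies. *)
Lemma exists_kernel A : proper_colouring A c ->
  exists K, [/\ K \subset A, {in K &, forall e e', adj e e' -> e = e'} &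
    {in A :\: K, forall e, exists2 e', e' \in K & dominates e e'}].
Proof.
move: {2}#|A| (leqnn #|A|) => m; elim: m A => [|m IH] A leAm pc.
  move: leAm; rewrite leqn0 cards_eq0 => /eqP ->.
  by exists set0; split=> // e; rewrite ?inE.
pose M := [set e in A | [forall e' in xstar A e, c e' <= c e]].
have MA e : e \in M -> e \in A by rewrite inE => /andP[].
have topM e e' : e \in M -> e' \in A -> x e' = x e -> c e' <= c e.
  by rewrite inE => /andP[_ /forall_inP top] e'A xe; apply: top; rewrite inE e'A xe /=.
have [indep|] := boolP [forall e in M, forall e' in M, (y e == y e') ==> (e == e')].
  exists M; split; first by apply/subsetP.
    move=> e e' eM e'M /orP[] /eqP eq_end.
      apply: pc; rewrite ?MA // /adj ?eq_end ?eqxx //; apply/eqP.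
      by rewrite eqn_leq !topM ?MA.
    move/forall_inP: indep => /(_ _ eM)/forall_inP/(_ _ e'M).
    by rewrite eq_end eqxx => /eqP.
  move=> e; rewrite inE => /andP[neM eA].
  have e_x : e \in xstar A e by rewrite inE eA /=.
  case: (@arg_maxnP _ e (fun f => f \in xstar A e) c e_x) => e'.
  rewrite inE => /andP[e'A /eqP xe'] top.
  have e'M : e' \in M.
    rewrite inE e'A; apply/forall_inP => f; rewrite inE => /andP[fA /eqP xf].
    by apply: top; rewrite inE fA xf xe' /=.
  exists e' => //; rewrite /dominates xe' eqxx ltn_neqAle [c e <= _](top e e_x) andbT /=.
  suff -> : c e != c e' by [].
  apply: contraNneq neM => cee; suff -> : e = e' by [].
  by apply: pc; rewrite // /adj xe' eqxx.
case/forall_inPn=> e1 e1M /forall_inPn[e2 e2M]; rewrite negb_imply.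
wlog lt12 : e1 e2 e1M e2M / c e1 < c e2 => [wl|] /andP[y12 n12].
  case: (ltngtP (c e1) (c e2)) => lt.
  - by apply: (wl e1 e2) => //; rewrite y12 n12.
  - by apply: (wl e2 e1) => //; rewrite eq_sym y12 eq_sym n12.
  by case/eqP: n12; apply: pc; rewrite ?MA // /adj y12 orbT.
have [||K [KA indep dom]] := IH (A :\ e2).
- by move: leAm; rewrite (cardsD1 e2) MA.
- by move=> e e'; rewrite !inE => /andP[_ eA] /andP[_ e'A]; apply: pc.
exists K; split=> //; first by apply: subset_trans KA (subsetDl _ _).
move=> e; rewrite inE => /andP[neK eA].
have [->|ne2] := eqVneq e e2; last by apply: dom; rewrite !inE neK ne2.
(* The rejected [e2] points to [e1]. If [e1] is outside [K], its arc into [K] must use the [Y] end,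
   as [e1] is top at its [X] end, and then [e2] points to the same edge. *)
have [e1K|ne1K] := boolP (e1 \in K).
  by exists e1; rewrite // /dominates y12 lt12 orbT.
have [|e' e'K] := dom e1; first by rewrite !inE ne1K n12 MA.
case/orP=> /andP[/eqP eq_end lt].
  have e'A : e' \in A by have := subsetP KA _ e'K; rewrite inE => /andP[].
  by have := topM e1 e' e1M e'A eq_end; rewrite leqNgt lt.
by exists e'; rewrite // /dominates eq_end y12 (ltn_trans lt lt12) orbT.
Qed.

(* The Bondy-Boppana-Siegel lemma: repeatedly give one colour to a kernel of the edges
   whose list contains it. *)
Lemma kernel_list_colouring (C : finType) (c0 : C) A (L : E -> {set C}) :
    proper_colouring A c -> {in A, forall e, #|[set e' in A | dominates e e']| < #|L e|} ->
  exists f : E -> C, {in A, forall e, f e \in L e} /\ proper_colouring A f.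
Proof.
move: {2}#|A| (leqnn #|A|) => m; elim: m A L => [|m IH] A L leAm pc ltL.
  move: leAm; rewrite leqn0 cards_eq0 => /eqP ->.
  by exists (fun=> c0); split=> e; rewrite inE.
have [->|[e0 e0A]] := set_0Vmem A.
  by exists (fun=> c0); split=> e; rewrite inE.
have [r rL] : exists r, r \in L e0.
  by apply/set0Pn; rewrite -card_gt0 (leq_ltn_trans _ (ltL e0 e0A)).
pose B := [set e in A | r \in L e].
have subBA : {subset B <= A} by move=> e; rewrite inE => /andP[].
have [|K [KB indep dom]] := @exists_kernel B.
  by move=> e e' /subBA eA /subBA e'A; apply: pc.
have KA : {subset K <= A} by move=> e /(subsetP KB)/subBA.
have /set0Pn[e1 e1K] : K != set0.
  apply/eqP => K0; have [|e'] := dom e0; first by rewrite !inE K0 inE e0A rL.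
  by rewrite K0 inE.
have [||| f [fL pf]] := IH (A :\: K) (fun e => L e :\ r).
- rewrite -ltnS; apply: leq_trans leAm; apply: proper_card.
  apply/properP; split; first exact: subsetDl.
  by exists e1; rewrite ?KA // inE e1K.
- by move=> e e'; rewrite !inE => /andP[_ eA] /andP[_ e'A]; apply: pc.
- move=> e eAK; have /andP[neK eA] : (e \notin K) && (e \in A) by rewrite inE in eAK.
  have sub : [set e' in A :\: K | dominates e e'] \subset [set e' in A | dominates e e'].
    by apply/subsetP => e'; rewrite !inE => /andP[/andP[_ ->]].
  have := ltL e eA; rewrite (cardsD1 r (L e)).
  (* An edge losing [r] from its list lies in [B] outside [K], so it also loses an out-neighbour in
     [K], and the strict inequality survives. *)
  have [rLe|_] := boolP (r \in L e); last exact: leq_ltn_trans (subset_leq_card sub).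
  rewrite add1n ltnS; apply: leq_trans; apply: proper_card; apply/properP; split=> //.
  have [|e' e'K de'] := dom e; first by rewrite !inE neK eA rLe.
  by exists e'; rewrite !inE ?e'K ?KA.
exists (fun e => if e \in K then r else f e); split.
  move=> e eA; case: ifPn => eK.
    by have := subsetP KB e eK; rewrite inE => /andP[].
  by have := fL e; rewrite !inE eK eA => /(_ isT)/andP[].
have fr e : e \in A -> e \notin K -> f e != r.
  by move=> eA eK; have := fL e; rewrite !inE eK eA => /(_ isT)/andP[].
move=> e e' eA e'A ad; case: ifPn => eK; case: ifPn => e'K eq_f.
- exact: indep.
- by have := fr e' e'A e'K; rewrite -eq_f eqxx.
- by have := fr e eA eK; rewrite eq_f eqxx.
- by apply: pf; rewrite // inE ?eK ?e'K.
Qed.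

End Kernels.

(** Orient by a [d]-colouring from [koenig]. Out-neighbours of [e] have larger colours at one end
    and smaller ones at the other, all distinct and different from that of [e], so there are fewer
    than [d]. *)
Theorem galvin (C : finType) (c0 : C) A (L : E -> {set C}) d :
    {in A, forall e, #|xstar A e| <= d} -> {in A, forall e, #|ystar A e| <= d} ->
    {in A, forall e, d <= #|L e|} ->
  exists f : E -> C, {in A, forall e, f e \in L e} /\ proper_colouring A f.
Proof.
move=> dx dy dL; have [c [c_lt pc]] := koenig dx dy.
apply: (kernel_list_colouring c0 pc) => e eA; apply: leq_trans (dL e eA).
set S := [set e' in A | _].
(* Out-neighbours of [e] with the same colour lie on the same side of [e]. *)
have inj : {in enum S &, injective c}.
  move=> e1 e2; rewrite !mem_enum !inE => /andP[e1A d1] /andP[e2A d2] eq_c.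
  apply: pc => //; move: d1 d2; rewrite /dominates /adj eq_c.
  case/orP=> /andP[/eqP-> lt1] /orP[] /andP[/eqP-> lt2]; rewrite ?eqxx ?orbT //.
    by have := ltn_trans lt1 lt2; rewrite ltnn.
  by have := ltn_trans lt1 lt2; rewrite ltnn.
have uniq_c : uniq (c e :: map c (enum S)).
  rewrite /= map_inj_in_uniq // enum_uniq andbT; apply/mapP => -[e'].
  by rewrite mem_enum inE => /andP[_]; rewrite /dominates => /[swap] ->; rewrite ltnn !andbF.
have := @uniq_leq_size _ _ (iota 0 d) uniq_c.
rewrite /= size_map -cardE size_iota; apply => z; rewrite inE mem_iota /= add0n.
case/orP=> [/eqP->|/mapP[e']]; first exact: c_lt.
by rewrite mem_enum inE => /andP[e'A _] ->; apply: c_lt.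
Qed.

End EdgeColouring.

Lemma card_ord_lt n m : m <= n -> #|[set i : 'I_n | i < m]| = m.
Proof.
move=> le_mn; have inj_w : injective (widen_ord le_mn).
  by move=> i j /(congr1 val) /= /val_inj.
rewrite -[RHS]card_ord -(card_codom inj_w) cardsE; apply: eq_card => i.
rewrite unfold_in; apply/idP/codomP => [lt_im|[j ->]]; last exact: (ltn_ord j).
by exists (Ordinal lt_im); apply: val_inj.
Qed.

Lemma leq_card_avoid (E F : finType) (p : E -> F) (S : {set E}) (D : {set F}) :
  {in S &, injective p} -> {in S, forall e, p e \notin D} -> #|S| <= #|F| - #|D|.
Proof.
move=> inj_p avoid; rewrite -(card_in_imset inj_p) -(cardsC D) addKn subset_leq_card //.
by apply/subsetP => _ /imsetP[e eS ->]; rewrite inE avoid.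
Qed.

(** * Completing [P] when its top left 2 x 3 block is a Latin rectangle on [T] *)

Section LatinBlock.

Variables (n : nat) (P : parray n) (T : {set 'I_n}).
Hypotheses (P23 : in_PLS23 P) (cardT : #|T| = 3).
Hypothesis T_block : forall i j s : 'I_n,
  i < 2 -> P i j = Some s -> (s \in T) = (j < 3).

Let rowP i j1 j2 s : P i j1 = Some s -> P i j2 = Some s -> j1 = j2.
Proof. by case: P23 => -[row _] _; apply: row. Qed.

Let colP j i1 i2 s : P i1 j = Some s -> P i2 j = Some s -> i1 = i2.
Proof. by case: P23 => -[_ col] _; apply: col. Qed.

Let shapeP (i j : 'I_n) : (P i j != None) = ((i < 2) || (j < 3)).
Proof. by case: P23. Qed.

Let filledP (i j : 'I_n) : (i < 2) || (j < 3) -> exists s, P i j = Some s.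
Proof. by rewrite -shapeP; case: (P i j) => // s _; exists s. Qed.

Let le3n : 3 <= n.
Proof. by rewrite -cardT -[n in _ <= n]card_ord max_card. Qed.

Let i0 : 'I_n := Ordinal (ltnW (ltnW le3n)).
Let i1 : 'I_n := Ordinal (ltnW le3n).

Let card_lt3 : #|[set j : 'I_n | j < 3]| = 3.
Proof. exact: card_ord_lt. Qed.

Lemma ord_lt2 (i : 'I_n) : i < 2 -> i = i0 \/ i = i1.
Proof. by case: i => [[|[|//]] lt] _; [left | right]; apply: val_inj. Qed.

Lemma row_full (i s : 'I_n) : i < 2 -> exists j, P i j = Some s.
Proof.
move=> lt_i; have /fin_all_exists[p Pp] (j : 'I_n) : exists s, P i j = Some s.
  by apply: filledP; rewrite lt_i.
have inj_p : injective p by move=> j1 j2 eq_p; apply: (@rowP i _ _ (p j1)); rewrite Pp ?eq_p.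
by exists (invF inj_p s); rewrite Pp f_invF.
Qed.

Lemma col_full (j s : 'I_n) : j < 3 -> exists i, P i j = Some s.
Proof.
move=> lt_j; have /fin_all_exists[p Pp] (i : 'I_n) : exists s, P i j = Some s.
  by apply: filledP; rewrite lt_j orbT.
have inj_p : injective p by move=> i1' i2 eq_p; apply: (@colP j _ _ (p i1')); rewrite Pp ?eq_p.
by exists (invF inj_p s); rewrite Pp f_invF.
Qed.

(** Pairs are read as (symbol, column), and the two projections serve as endpoint maps. *)
Definition open_places : {set 'I_n * 'I_n} :=
  [set e : 'I_n * 'I_n | [&& e.1 \notin T, 3 <= e.2 &
    [forall i : 'I_n, (i < 2) ==> (P i e.2 != Some e.1)]]].

Definition open_rows (e : 'I_n * 'I_n) : {set 'I_n} :=
  [set r : 'I_n | (2 <= r) && [forall j : 'I_n, (j < 3) ==> (P r j != Some e.1)]].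

(** Five columns are barred: the first three and the two holding the symbol in rows 1 and 2. They
    are distinct since a symbol outside [T] avoids the 2 x 3 block. *)
Lemma card_symbol_places : {in open_places, forall e, #|xstar fst open_places e| <= n - 5}.
Proof.
move=> [s c]; rewrite inE => /and3P[/= sT _ _].
have [c0 Pc0] := @row_full i0 s isT; have [c1 Pc1] := @row_full i1 s isT.
have c01 : c0 != c1.
  by apply/eqP => eqc; move: Pc0; rewrite eqc => /colP/(_ Pc1)/(congr1 val).
have c0_ge : (c0 < 3) = false by rewrite -(T_block _ Pc0) ?(negPf sT).
have c1_ge : (c1 < 3) = false by rewrite -(T_block _ Pc1) ?(negPf sT).
pose D := c0 |: (c1 |: [set c : 'I_n | c < 3]).
have cardD : #|D| = 5.
  by rewrite !cardsU1 !inE card_lt3 c0_ge c1_ge (negPf c01).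
rewrite -cardD -[X in X - _]card_ord; apply: (leq_card_avoid (p := snd)).
  by move=> [s1 j1] [s2 j2]; rewrite !inE /= => /andP[_ /eqP->] /andP[_ /eqP->] ->.
move=> [s' j]; rewrite !inE /= => /andP[/and3P[_ j_ge /forallP avoid] /eqP es].
rewrite ltnNge j_ge orbF; apply/norP; split; apply/eqP => ej.
  by have := avoid i0; rewrite /= ej es Pc0 eqxx.
by have := avoid i1; rewrite /= ej es Pc1 eqxx.
Qed.

(** Five symbols are barred: those of [T] and the two entries of the column in rows 1 and 2, which
    are outside [T] beyond the third column. *)
Lemma card_column_places : {in open_places, forall e, #|ystar snd open_places e| <= n - 5}.
Proof.
move=> [s c]; rewrite inE => /and3P[/= _ c_ge _].
have [s0 Ps0] : exists s, P i0 c = Some s by apply: filledP.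
have [s1 Ps1] : exists s, P i1 c = Some s by apply: filledP.
have s01 : s0 != s1.
  by apply/eqP => eqs; move: Ps0; rewrite eqs => /colP/(_ Ps1)/(congr1 val).
have s0T : (s0 \in T) = false by rewrite (T_block _ Ps0) // ltnNge c_ge.
have s1T : (s1 \in T) = false by rewrite (T_block _ Ps1) // ltnNge c_ge.
pose D := s0 |: (s1 |: T).
have cardD : #|D| = 5 by rewrite !cardsU1 !inE cardT s0T s1T (negPf s01).
rewrite -cardD -[X in X - _]card_ord; apply: (leq_card_avoid (p := fst)).
  by move=> [t1 j1] [t2 j2]; rewrite !inE /= => /andP[_ /eqP->] /andP[_ /eqP->] ->.
move=> [t j]; rewrite !inE /= => /andP[/and3P[/negPf-> _ /forallP avoid] /eqP ej].
rewrite orbF; apply/norP; split; apply/eqP => et.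
  by have := avoid i0; rewrite /= ej et Ps0 eqxx.
by have := avoid i1; rewrite /= ej et Ps1 eqxx.
Qed.

(** At most five rows are barred: the first two, and the one holding the symbol in each of the first
    three columns. *)
Lemma card_open_rows e : n - 5 <= #|open_rows e|.
Proof.
have /fin_all_exists[p Pp] (j : 'I_n) : exists i, j < 3 -> P i j = Some e.1.
  have [lt_j|] := boolP (j < 3); last by exists j.
  by have [i Pi] := col_full e.1 lt_j; exists i.
rewrite [#|_|]cardsCs card_ord leq_sub2l //.
have le5 : #|[set i : 'I_n | i < 2] :|: p @: [set j : 'I_n | j < 3]| <= 5.
  rewrite cardsU (leq_trans (leq_subr _ _)) // card_ord_lt ?(ltnW le3n) //.
  by rewrite (leq_add2l 2 _ 3) (leq_trans (leq_imset_card _ _)) ?card_lt3.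
apply: leq_trans le5; apply: subset_leq_card; apply/subsetP => r.
rewrite !inE negb_and -ltnNge => /orP[->//|/forallPn[j]].
rewrite negb_imply negbK => /andP[lt_j /eqP Pr]; apply/orP; right.
by apply/imsetP; exists j; rewrite ?inE //; apply: colP Pr (Pp j lt_j).
Qed.

(** Rows serve as colours. Properness at a symbol prevents repetition in a row, properness at a
    column prevents two symbols in one cell; the lists avoid clashes with the filled columns,
    openness with the filled rows. *)
Lemma place_other_symbols :
  exists Q : parray n,
    [/\ is_PLS Q, forall i j s, P i j = Some s -> Q i j = Some s,
        forall i j s, Q i j = Some s -> P i j = Some s \/ s \notin T &
        forall s j, s \notin T -> exists i, Q i j = Some s].
Proof.
have [f [f_row f_proper]] := galvin i0 card_symbol_places card_column_places
  (fun e _ => card_open_rows e).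
pose Q i j := if P i j is Some s then Some s
  else [pick s | ((s, j) \in open_places) && (f (s, j) == i)].
have QP i j s : P i j = Some s -> Q i j = Some s by rewrite /Q => ->.
have Qinv i j s : Q i j = Some s ->
    P i j = Some s \/ (s, j) \in open_places /\ f (s, j) = i.
  rewrite /Q; case: (P i j) => [s'|]; first by left.
  by case: pickP => // s' /andP[sj /eqP fsj] [<-]; right.
have Qf s j : (s, j) \in open_places -> Q (f (s, j)) j = Some s.
  move=> sj; have Pnone : P (f (s, j)) j = None.
    have := f_row _ sj; rewrite inE => /andP[f_ge _].
    have := sj; rewrite inE => /and3P[_ /= j_ge _].
    by apply/eqP; rewrite -[_ == _]negbK shapeP negb_or -!leqNgt f_ge.
  rewrite /Q Pnone; case: pickP => [s' /andP[s'j /eqP eqf]|/(_ s)]; last by rewrite sj eqxx.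
  have [-> //] : (s', j) = (s, j).
  by apply: f_proper => //; rewrite /adj /= eqxx orbT.
have Pf i j j' s : (s, j) \in open_places -> f (s, j) = i -> P i j' <> Some s.
  move=> sj fi Ps; have := f_row _ sj; rewrite fi inE => /andP[i_ge /forallP/(_ j')].
  rewrite Ps eqxx implybF => j'_ge.
  by have := shapeP i j'; rewrite Ps ltnNge i_ge (negPf j'_ge).
have Pf' i i' j s : (s, j) \in open_places -> f (s, j) = i -> P i' j <> Some s.
  rewrite inE => /and3P[_ /= j_ge /forallP/(_ i')] avoid _ Ps.
  rewrite Ps eqxx implybF in avoid.
  by have := shapeP i' j; rewrite Ps (negPf avoid) ltnNge j_ge.
exists Q; split=> //; first split.
- move=> i j1 j2 s /Qinv[P1|[o1 f1]] /Qinv[P2|[o2 f2]].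
  + exact: rowP P1 P2.
  + by case: (Pf _ _ j1 _ o2 f2).
  + by case: (Pf _ _ j2 _ o1 f1).
  + have [//] : (s, j1) = (s, j2).
    by apply: f_proper; rewrite ?f1 ?f2 // /adj /= eqxx.
- move=> j r1 r2 s /Qinv[P1|[o1 f1]] /Qinv[P2|[o2 f2]].
  + exact: colP P1 P2.
  + by case: (Pf' _ r1 _ _ o2 f2).
  + by case: (Pf' _ r2 _ _ o1 f1).
  + by rewrite -f1 f2.
- move=> i j s /Qinv[|[]]; [by left | rewrite inE => /and3P[sT _ _] _].
  by right.
- move=> s j sT; have [lt_j|j_ge] := ltnP j 3.
    by have [i Pi] := col_full s lt_j; exists i; apply: QP.
  have [/existsP[i /andP[_ /eqP Pi]]|none] := boolP [exists i : 'I_n, (i < 2) && (P i j == Some s)].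
    by exists i; apply: QP.
  exists (f (s, j)); apply: Qf; rewrite inE /= sT j_ge; apply/forallP => i.
  by apply/implyP => lt_i; apply: contraNN none => Pi; apply/existsP; exists i; rewrite lt_i.
Qed.

(** Within the first three columns, [t] takes two different columns in rows 1 and 2, so any lower
    occurrence is in the remaining one. *)
Lemma T_cell_uniq (i j i' j' t : 'I_n) : t \in T -> 2 <= i -> 2 <= i' -> j < 3 -> j' < 3 ->
  P i j = Some t -> P i' j' = Some t -> (i, j) = (i', j').
Proof.
move=> tT i_ge i'_ge lt_j lt_j' Pt Pt'.
have [c0 Pc0] := @row_full i0 t isT; have [c1 Pc1] := @row_full i1 t isT.
have lt_c0 : c0 < 3 by rewrite -(T_block _ Pc0).
have lt_c1 : c1 < 3 by rewrite -(T_block _ Pc1).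
have sep (a b ca cb : 'I_n) :
    P a ca = Some t -> P b cb = Some t -> a <> b :> nat -> ca <> cb :> nat.
  by move=> Pa Pb ab /val_inj eqc; apply: ab; move: Pa; rewrite eqc => /colP/(_ Pb) ->.
have n01 := sep _ _ _ _ Pc0 Pc1 ltac:(by []).
have n0 := sep _ _ _ _ Pc0 Pt ltac:(simpl; lia).
have n1 := sep _ _ _ _ Pc1 Pt ltac:(simpl; lia).
have n0' := sep _ _ _ _ Pc0 Pt' ltac:(simpl; lia).
have n1' := sep _ _ _ _ Pc1 Pt' ltac:(simpl; lia).
have ej : j = j' by apply: val_inj => /=; lia.
by rewrite -ej in Pt' *; rewrite (colP Pt Pt').
Qed.

Lemma T_cell_exists t : t \in T ->
  exists e : 'I_n * 'I_n, [/\ 2 <= e.1, e.2 < 3 & P e.1 e.2 = Some t].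
Proof.
move=> tT; have [c0 Pc0] := @row_full i0 t isT; have [c1 Pc1] := @row_full i1 t isT.
have lt_c0 : c0 < 3 by rewrite -(T_block _ Pc0).
have lt_c1 : c1 < 3 by rewrite -(T_block _ Pc1).
have c01 : c0 <> c1 :> nat.
  by move=> /val_inj eqc; move: Pc0; rewrite eqc => /colP/(_ Pc1)/(congr1 val).
have [j lt_j [nj0 nj1]] : exists2 j : 'I_n, j < 3 & j <> c0 /\ j <> c1.
  (* The column indices 0, 1, 2 add up to 3, so this difference is the column left over by [c0] and
     [c1]. *)
  have lt_n : 3 - c0 - c1 < n by apply: leq_trans le3n; lia.
  by exists (Ordinal lt_n); [|split=> /(congr1 val)]; rewrite /=; lia.
have [i Pi] := col_full t lt_j; exists (i, j); split=> //=.
rewrite leqNgt; apply/negP => /ord_lt2[] ei; rewrite ei in Pi.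
  exact: nj0 (rowP Pi Pc0).
exact: nj1 (rowP Pi Pc1).
Qed.

(** [h] stands for one row or column of an array: the [n - 3] symbols outside [T] take distinct
    positions, all outside [S]. *)
Lemma card_missing_T (S : {set 'I_n}) (h : 'I_n -> option 'I_n) :
  (forall s, s \notin T -> exists2 i, i \notin S & h i = Some s) -> #|S| <= 3.
Proof.
move=> hs; have /fin_all_exists[g gP] (s : 'I_n) :
    exists i, s \notin T -> i \notin S /\ h i = Some s.
  have [sT|sT] := boolP (s \in T); first by exists s.
  by have [i iS hi] := hs s sT; exists i.
have : #|~: T| <= #|'I_n| - #|S|.
  apply: (leq_card_avoid (p := g)) => [s1 s2|s]; rewrite !inE.
    by move=> /gP[_ h1] /gP[_ h2] eq_g; move: h1; rewrite eq_g h2 => -[].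
  by case/gP.
have := cardsC T; have := cardsC S; rewrite cardT card_ord; lia.
Qed.

Lemma Latin_block_completable : completable P.
Proof.
have [Q [[Qrow Qcol] QP QT Qfull]] := place_other_symbols.
(* [s] lies in every column, in pairwise different rows, hence in every row. *)
have Qrow_full s i : s \notin T -> exists j, Q i j = Some s.
  move=> sT; have /fin_all_exists[p Pp] (j : 'I_n) := Qfull s j sT.
  have inj_p : injective p.
    by move=> j1 j2 eq_p; apply: (Qrow (p j1) _ _ s); rewrite // eq_p.
  by exists (invF inj_p i); have := Pp (invF inj_p i); rewrite f_invF.
(* [None] is the vertex into which the first three columns are merged. *)
pose y (e : 'I_n * 'I_n) := if e.2 < 3 then None else Some e.2.
(* Prescribed cells with a symbol of [T] are kept as edges beside the empty ones, so that the
   colouring has to take them into account. *)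
pose A := [set e : 'I_n * 'I_n | (2 <= e.1) && (if Q e.1 e.2 is Some s then s \in T else true)].
have A_T i j s : (i, j) \in A -> Q i j = Some s -> s \in T.
  by rewrite inE /= => /andP[_] /[swap] ->.
have small (i j : 'I_n) : (i < 2) || (j < 3) -> exists2 s, P i j = Some s & Q i j = Some s.
  by move/filledP=> [s Ps]; exists s; rewrite ?(QP _ _ _ Ps).
have dx : {in A, forall e, #|xstar fst A e| <= 3}.
  move=> [i j] _; rewrite -(card_in_imset (f := snd)); last first.
    by move=> [a1 b1] [a2 b2]; rewrite !inE /= => /andP[_ /eqP->] /andP[_ /eqP->] ->.
  apply: (card_missing_T (h := Q i)) => s sT; have [c Qc] := Qrow_full s i sT.
  exists c => //; apply: contra sT => /imsetP[[a b]]; rewrite inE /= => /andP[abA /eqP ea] eb.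
  by apply: A_T abA _; rewrite ea -eb.
have dy : {in A, forall e, #|ystar y A e| <= 3}.
  move=> [i j] _; have [lt_j|j_ge] := ltnP j 3.
    (* The degree of the merged vertex is bounded by reading off symbols, since each symbol of [T]
       has one cell there. The default is never reached on these filled cells. *)
    pose v (e : 'I_n * 'I_n) := odflt e.1 (P e.1 e.2).
    have vP e : e \in ystar y A (i, j) ->
        [/\ 2 <= e.1, e.2 < 3, v e \in T & P e.1 e.2 = Some (v e)].
      case: e => a b; rewrite inE {1}/y /= /y /= lt_j => /andP[abA].
      case: ifP => // lt_b _; have [s Ps Qs] := @small a b (introT orP (or_intror lt_b)).
      rewrite /v /= Ps /=; split=> //; last exact: A_T abA Qs.
      by move: abA; rewrite inE => /andP[].
    rewrite -cardT -(card_in_imset (f := v)).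
      by apply: subset_leq_card; apply/subsetP => _ /imsetP[e /vP[_ _ vT _] ->].
    move=> [a1 b1] [a2 b2] /vP[/= a1g b1g vT P1] /vP[/= a2g b2g _ P2] eq_v.
    by apply: (T_cell_uniq vT) => //; rewrite P2 eq_v.
  have ystarP e : e \in ystar y A (i, j) -> e \in A /\ e.2 = j.
    rewrite inE /y [(i, j).2 < 3]ltnNge j_ge /= => /andP[eA].
    by case: ifP => // _ /eqP[].
  rewrite -(card_in_imset (f := fst)); last first.
    by move=> [a1 b1] [a2 b2] /ystarP[_ /= ->] /ystarP[_ /= ->] ->.
  apply: (card_missing_T (h := Q^~ j)) => s sT; have [r Qr] := Qfull s j sT.
  exists r => //; apply: contra sT => /imsetP[[a b] /ystarP[abA /= eb] ea].
  by apply: A_T abA _; rewrite eb -ea.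
have [g [gT g_proper]] := galvin i0 dx dy (fun e _ => eq_leq (esym cardT)).
have /fin_all_exists[w wP] (t : 'I_n) : exists e : 'I_n * 'I_n,
    t \in T -> [/\ 2 <= e.1, e.2 < 3 & P e.1 e.2 = Some t].
  have [/T_cell_exists[e eP]|_] := boolP (t \in T); first by exists e.
  by exists (i0, i0).
have wA t : t \in T -> w t \in A.
  by move=> tT; have [wge _ Pw] := wP t tT; rewrite inE wge (QP _ _ _ Pw).
(* The cells [w t] all meet in the merged vertex, so properness gives them distinct colours and
   [g \o w] permutes [T]. *)
have gw_inj : {in T &, injective (g \o w)}.
  move=> t1 t2 t1T t2T eq_g; have [_ lt1 P1] := wP _ t1T; have [_ lt2 P2] := wP _ t2T.
  suff ew : w t1 = w t2 by move: P1; rewrite ew P2 => -[].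
  by apply: g_proper eq_g; rewrite ?wA // /adj /y lt1 lt2 eqxx orbT.
have gw_onto : (g \o w) @: T = T.
  apply/eqP; rewrite eqEcard card_in_imset // leqnn andbT.
  by apply/subsetP => _ /imsetP[t tT ->]; apply: gT; apply: wA.
(* Rename the colours so that prescribed cells with a symbol of [T] get that symbol. *)
have /fin_all_exists[h hP] (e : 'I_n * 'I_n) :
    exists t, e \in A -> t \in T /\ g (w t) = g e.
  have [eA|_] := boolP (e \in A); last by exists i0.
  by have := gT e eA; rewrite -{1}gw_onto => /imsetP[t tT eq_g]; exists t.
have h_inj e e' : e \in A -> e' \in A -> adj fst y e e' -> h e = h e' -> e = e'.
  move=> eA e'A ad eq_h; apply: g_proper => //.
  by have [_ <-] := hP e eA; have [_ <-] := hP e' e'A; rewrite eq_h.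
pose L i j := if Q i j is Some s then s else h (i, j).
have QL i j s : Q i j = Some s -> L i j = s by rewrite /L => ->.
have LnotT i j : L i j \notin T -> Q i j = Some (L i j).
  rewrite /L; case Qij: (Q i j) => [//|]; have [lt|] := boolP ((i < 2) || (j < 3)).
    by have [s _] := small i j lt; rewrite Qij.
  rewrite negb_or -!leqNgt => /andP[i_ge _].
  have ijA : (i, j) \in A by rewrite inE /= i_ge Qij.
  by case: (hP _ ijA) => ->.
have LinT (i j : 'I_n) : 2 <= i -> L i j \in T -> (i, j) \in A.
  by rewrite /L inE /= => ->; case: (Q i j).
(* Where [Q] already holds a symbol [t] of [T], the cell is [w t], so the renamed colour is [t]
   itself. *)
have Lh i j : (i, j) \in A -> L i j = h (i, j).
  move=> ijA; rewrite /L; case Qij: (Q i j) => [t|//].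
  have tT := A_T _ _ _ ijA Qij; have [Pt|] := QT _ _ _ Qij; last by rewrite tT.
  have i_ge : 2 <= i by move: ijA; rewrite inE => /andP[].
  have lt_j : j < 3 by have := shapeP i j; rewrite Pt ltnNge i_ge => /esym.
  have [wge wlt Pw] := wP t tT.
  have ew : w t = (i, j) by case: (w t) wge wlt Pw => a b /= ? ? ?; apply: (T_cell_uniq tT).
  have [hT eq_g] := hP _ ijA.
  by apply: gw_inj; rewrite //= eq_g ew.
exists L; split; [|split] => [i j1 j2 eqL|j r1 r2 eqL|i j s /QP /QL //].
  have [lt_i|i_ge] := ltnP i 2.
    have [s1 _ Q1] := small i j1 (introT orP (or_introl lt_i)).
    have [s2 _ Q2] := small i j2 (introT orP (or_introl lt_i)).
    by move: eqL; rewrite (QL _ _ _ Q1) (QL _ _ _ Q2) => es; apply: (Qrow i _ _ s1); rewrite // es.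
  have [LT|LT] := boolP (L i j1 \in T).
    have A1 := LinT _ _ i_ge LT; have A2 : (i, j2) \in A by apply: LinT; rewrite -?eqL.
    have [//] : (i, j1) = (i, j2).
    by apply: h_inj; rewrite -?Lh // /adj eqxx.
  by apply: (Qrow i _ _ (L i j1)); [exact: LnotT | rewrite eqL LnotT // -eqL].
have [lt_j|j_ge] := ltnP j 3.
  have [s1 _ Q1] := small r1 j (introT orP (or_intror lt_j)).
  have [s2 _ Q2] := small r2 j (introT orP (or_intror lt_j)).
  by move: eqL; rewrite (QL _ _ _ Q1) (QL _ _ _ Q2) => es; apply: (Qcol j _ _ s1); rewrite // es.
have [LT|LT] := boolP (L r1 j \in T); last first.
  by apply: (Qcol j _ _ (L r1 j)); [exact: LnotT | rewrite eqL LnotT // -eqL].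
(* Beyond the third column, rows 1 and 2 carry no symbol of [T], so a repeated symbol of [T] would
   occupy two cells of [A]. *)
have T_low (r : 'I_n) : L r j \in T -> 2 <= r.
  rewrite leqNgt => LrT; apply/negP => lt_r.
  have [s Ps Qs] := small r j (introT orP (or_introl lt_r)).
  by move: LrT; rewrite (QL _ _ _ Qs) (T_block lt_r Ps) ltnNge j_ge.
have A1 := LinT _ _ (T_low _ LT) LT.
have A2 : (r2, j) \in A by rewrite eqL in LT; apply: LinT (T_low _ LT) LT.
have [//] : (r1, j) = (r2, j).
by apply: h_inj; rewrite -?Lh // /adj /y eqxx orbT.
Qed.

End LatinBlock.

(** * From the cycle structure of [sigma] to the block condition *)

Theorem theorem7 (k n : nat) (P : parray n) (sigma : {perm 'I_n}) :
  3 <= k ->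
  in_PLS23 P ->
  row12_perm P sigma ->
  (* exactly one 3-cycle, equal (as a set) to T *)
  [set X in porbits sigma | #|X| == 3] = [set first3 P] ->
  (* every cycle has length 3 or 2 (the disjoint cycle representation
     consists only of these cycles) *)
  (forall X, X \in porbits sigma -> (#|X| == 3) || (#|X| == 2)) ->
  (* exactly k+2 cycles of length 2, none meeting T *)
  #|[set X in porbits sigma | #|X| == 2]| = k + 2 ->
  (forall X, X \in porbits sigma -> #|X| == 2 -> [disjoint X & first3 P]) ->
  completable P.
Proof.
move=> _ P23 row12 cycle3 _ _ _.
have : first3 P \in [set first3 P] by rewrite inE.
rewrite -cycle3 inE => /andP[/imsetP[t0 _ T_orbit] /eqP cardT].
have sigmaT s : (sigma s \in first3 P) = (s \in first3 P).
  rewrite T_orbit -!eq_porbit_mem.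
  by have /eqP-> : porbit sigma (sigma s) == porbit sigma s
    by rewrite eq_porbit_mem (mem_porbit sigma 1).
apply: (Latin_block_completable P23 cardT) => i j s lt_i Ps.
have [[row _] shape] := P23.
have row0 (i' : 'I_n) t : val i' = 0 -> P i' j = Some t -> (t \in first3 P) = (j < 3).
  move=> i'0 Pt; rewrite inE; apply/existsP/idP => [[a /existsP[b]]|lt_j].
    case/and3P=> /eqP a0 lt_b /eqP Pb.
    have ea : a = i' by apply: val_inj; rewrite a0.
    by rewrite ea in Pb; rewrite (row _ _ _ _ Pt Pb).
  by exists i'; apply/existsP; exists j; rewrite i'0 lt_j Pt !eqxx.
(* Row 1 is settled by the definition of [T]; row 2 is its image under [sigma], which preserves
   [T]. *)
case: (posnP (val i)) => [i_0|i_gt]; first exact: row0 Ps.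
have i_1 : val i = 1 by apply/eqP; rewrite eqn_leq i_gt -ltnS lt_i.
have lt0n : 0 < n by apply: leq_ltn_trans (ltn_ord i).
have := row12 (Ordinal lt0n) i j erefl i_1; rewrite Ps.
case P0: (P _ j) => [t|//] [->]; rewrite sigmaT; exact: row0 P0.
Qed.
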